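(* Let $q\in(0,1)$, $1\le k\le N$, $G\in\{B,C,D\}$, and $$c_{k,N}^G(q)=\prod_{i=1}^k\frac{(q^i,q^{k+i-1+2\epsilon};q)_{N-k}}{(q^{i-1+2\epsilon},q^{1-i};q)_{i-1}(q,q^{2i-1+2\epsilon};q)_{N-i}}.$$ Then for any $\lambda\in\mathbb{GT}^+_N$ and $x_1,\ldots,x_k\in\mathbb C^*$, $$\frac{\chi_\lambda^G(x_1,\ldots,x_k,q^{k+\epsilon},\ldots,q^{N-1+\epsilon})}{\chi_\lambda^G(q^\epsilon,q^{1+\epsilon},\ldots,q^{N-1+\epsilon})}=c_{k,N}^G(q)\cdot\frac{V^s(q^\epsilon,q^{1+\epsilon},\ldots,q^{k-1+\epsilon})}{V^s(x_1,x_2,\ldots,x_k)}$$ $$\times\det_{1\le i,j\le k}\left[\frac{\chi_\lambda^G(q^\epsilon,\ldots,q^{j-2+\epsilon},x_i,q^{j+\epsilon},\ldots,q^{N-1+\epsilon})}{\chi_\lambda^G(q^\epsilon,q^{1+\epsilon},\ldots,q^{N-1+\epsilon})}(q^\epsilon x_i,q^\epsilon/x_i;q)_{j-1}(q^{j+\epsilon}x_i,q^{j+\epsilon}/x_i;q)_{k-j}\right].$$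
   Context: $\epsilon=\frac12,1,0$ for $G=B,C,D$ respectively; $\mathbb C^*=\mathbb C\setminus\{0\}$. $\mathbb{GT}^+_N$ is the set of $\lambda=(\lambda_1\ge\cdots\ge\lambda_N\ge0)\in\mathbb Z^N$. $(a;q)_n=\prod_{i=1}^n(1-aq^{i-1})$ and $(a_1,\ldots,a_r;q)_n=\prod_l(a_l;q)_n$. $V^s(z_1,\ldots,z_N)=\prod_{1\le i<j\le N}(z_i+z_i^{-1}-z_j-z_j^{-1})$, and $\chi^G_\lambda$ is the Laurent polynomial $$\chi^G_\lambda(z_1,\ldots,z_N)=\frac{1}{V^s(z_1,\ldots,z_N)}\times\begin{cases}\det_{1\le i,j\le N}\Big[\frac{z_j^{\lambda_i+N-i+1/2}-z_j^{-(\lambda_i+N-i+1/2)}}{z_j^{1/2}-z_j^{-1/2}}\Big],&G=B,\\ \det_{1\le i,j\le N}\Big[\frac{z_j^{\lambda_i+N-i+1}-z_j^{-(\lambda_i+N-i+1)}}{z_j-z_j^{-1}}\Big],&G=C,\\ \det_{1\le i,j\le N}\big[z_j^{\lambda_i+N-i}+z_j^{-(\lambda_i+N-i)}\big],&G=D.\end{cases}$$ In the $(i,j)$ entry, the arguments are the list $q^\epsilon,q^{1+\epsilon},\ldots,q^{N-1+\epsilon}$ with the entry $q^{j-1+\epsilon}$ replaced by $x_i$. The identity is one of rational functions; where $V^s(x_1,\ldots,x_k)=0$ the right-hand side is understood by continuity. *)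

(* Defs.v *)
From HB Require Import structures.
From mathcomp Require Import all_boot all_order all_algebra.
From mathcomp Require Import all_classical all_reals all_analysis.
From mathcomp Require Import complex.
From mathcomp Require Import perm zify ring.

Set Implicit Arguments.
Unset Strict Implicit.
Unset Printing Implicit Defensive.

Import Order.TTheory GRing.Theory Num.Theory.
Import numFieldNormedType.Exports.

Local Open Scope classical_set_scope.
Local Open Scope ring_scope.

(* The topology of the complex numbers, given by the modulus. *)
HB.instance Definition _ (R : rcfType) := NormedModule.copy R[i] R[i]^o.

Inductive BCD : Type := GB | GC | GD.

Section Defs.
Variable R : realType.
Local Notation C := R[i].
Implicit Types (G : BCD) (N n : nat).

Definition eps G : R := match G with GB => 2^-1 | GC => 1 | GD => 0 end.

Definition GTplus N (lam : 'I_N -> int) : Prop :=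
  (forall i j : 'I_N, (i <= j)%N -> lam j <= lam i) /\ (forall i, 0 <= lam i).

(* The real power q^r, seen as a complex number. *)
Definition qpow (q r : R) : C := (q `^ r)%:C%C.

(* qpoch q n [:: a_1; ...; a_r] is (a_1, ..., a_r; q)_n. *)
Definition qpoch (q : R) n (s : seq C) : C :=
  \prod_(a <- s) \prod_(1 <= i < n.+1) (1 - a * q%:C%C ^+ i.-1).

Definition Vs n (z : 'I_n -> C) : C :=
  \prod_(i < n) \prod_(j < n | (i < j)%N)
    (z i + (z i)^-1 - z j - (z j)^-1).

(* A Laurent polynomial in N variables, as a formal sum of pairs
   (coefficient, exponent vector). *)
Definition laurent N : Type := seq (C * {ffun 'I_N -> int}).

Definition leval N (p : laurent N) (z : 'I_N -> C) : C :=
  \sum_(m <- p) m.1 * \prod_(j < N) z j ^ m.2 j.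

(* Numerator and denominator of the determinant entries, with l standing for
   lambda_i + N - i. For type B the powers of z^(1/2) are odd powers of
   sqrtC z; the quotient does not depend on the choice of the root. *)
Definition entry_num G (l : int) (z : C) : C :=
  match G with
  | GB => sqrtC z ^ (2 * l + 1) - sqrtC z ^ (- (2 * l + 1))
  | GC => z ^ (l + 1) - z ^ (- (l + 1))
  | GD => z ^ l + z ^ (- l)
  end.

Definition entry_den G (z : C) : C :=
  match G with
  | GB => sqrtC z - (sqrtC z)^-1
  | GC => z - z^-1
  | GD => 1
  end.

(* Indices start at 0, so that lambda_i + N - i reads lam i + N - (i + 1). *)
Definition chi_formula G N (lam : 'I_N -> int) (z : 'I_N -> C) : C :=
  (Vs z)^-1 *
  \det (\matrix_(i < N, j < N)
    (entry_num G (lam i + (N%:Z - i.+1%:Z)) (z j) / entry_den G (z j))).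

(* The points where chi_formula involves no division by zero. *)
Definition chi_generic G N (z : 'I_N -> C) : Prop :=
  [/\ forall j, z j != 0, forall j, entry_den G (z j) != 0 & Vs z != 0].

Definition is_chi G N (lam : 'I_N -> int) (p : laurent N) : Prop :=
  forall z, chi_generic G z -> leval p z = chi_formula G lam z.

(* The Laurent polynomial chi^G_lambda; it exists (is_chi_chi_poly below), and
   its values at points with nonzero coordinates are determined by is_chi, as
   the generic points are dense. *)
Definition chi_poly G N (lam : 'I_N -> int) : laurent N :=
  xget [::] [set p | is_chi G lam p].

Definition chi G N (lam : 'I_N -> int) (z : 'I_N -> C) : C :=
  leval (chi_poly G lam) z.

(* The list q^eps, q^(1+eps), ..., q^(n-1+eps). *)
Definition qpts G (q : R) n : 'I_n -> C := fun l => qpow q (l%:R + eps G).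
Arguments qpts : clear implicits.

(* x_1, ..., x_k, q^(k+eps), ..., q^(N-1+eps). *)
Definition qpts_prefix G (q : R) N k (x : 'I_k -> C) : 'I_N -> C :=
  fun l => if insub (val l) is Some i then x i else qpts G q N l.
Arguments qpts_prefix : clear implicits.

(* q^eps, ..., q^(N-1+eps) with the entry of (0-based) index j replaced by y. *)
Definition qpts_subst G (q : R) N (j : nat) (y : C) : 'I_N -> C :=
  fun l => if val l == j then y else qpts G q N l.
Arguments qpts_subst : clear implicits.

Definition ckN G (q : R) (k N : nat) : C :=
  \prod_(1 <= i < k.+1)
    (qpoch q (N - k)
       [:: qpow q i%:R; qpow q (k%:R + i%:R - 1 + 2 * eps G)]
     / (qpoch q i.-1 [:: qpow q (i%:R - 1 + 2 * eps G); qpow q (1 - i%:R)]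
        * qpoch q (N - i)
            [:: qpow q 1; qpow q (2 * i%:R - 1 + 2 * eps G)])).

(* The determinant indices start at 0: (..;q)_(j-1) and (..;q)_(k-j) become
   qpoch q j and qpoch q (k - j.+1). *)
Definition det_rhs G (q : R) (k N : nat) (lam : 'I_N -> int)
    (x : 'I_k -> C) : C :=
  ckN G q k N * (Vs (qpts G q k) / Vs x) *
  \det (\matrix_(i < k, j < k)
    (chi G lam (qpts_subst G q N j (x i)) / chi G lam (qpts G q N)
     * qpoch q j [:: qpow q (eps G) * x i; qpow q (eps G) / x i]
     * qpoch q (k - j.+1) [:: qpow q (j.+1%:R + eps G) * x i;
                              qpow q (j.+1%:R + eps G) / x i])).

Definition chi_lhs G (q : R) (k N : nat) (lam : 'I_N -> int)
    (x : 'I_k -> C) : C :=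
  chi G lam (qpts_prefix G q N k x) / chi G lam (qpts G q N).

(* Existence of chi_poly: with t_j = z_j + 1/z_j, the (i, j) entry is a
   polynomial in t_j (entryP), and Newton's divided differences (dd) factor the
   Vandermonde product Vs out of the determinant. *)

Definition islaurent N (f : ('I_N -> C) -> C) : Prop :=
  exists p : laurent N, forall z, (forall j, z j != 0) -> leval p z = f z.

Lemma islaurent_const N (c : C) : islaurent (fun _ : 'I_N -> C => c).
Proof.
exists [:: (c, [ffun => 0])] => z _; rewrite /leval big_seq1 /= big1 ?mulr1 //.
by move=> j _; rewrite ffunE expr0z.
Qed.

Lemma islaurent_exp N (i : 'I_N) (e : int) :
  islaurent (fun z : 'I_N -> C => z i ^ e).
Proof.
exists [:: (1, [ffun j => if j == i then e else 0])] => z _.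
rewrite /leval big_seq1 /= mul1r (bigD1 i) //= ffunE eqxx big1 ?mulr1 //.
by move=> j /negbTE ji; rewrite ffunE ji expr0z.
Qed.

Lemma islaurentD N (f g : ('I_N -> C) -> C) :
  islaurent f -> islaurent g -> islaurent (fun z => f z + g z).
Proof.
move=> [p pf] [r rg]; exists (p ++ r) => z z0.
by rewrite /leval big_cat /= -!/(leval _ _) pf ?rg.
Qed.

Lemma islaurentM N (f g : ('I_N -> C) -> C) :
  islaurent f -> islaurent g -> islaurent (fun z => f z * g z).
Proof.
move=> [p pf] [r rg].
pose mm (a b : C * {ffun 'I_N -> int}) : C * {ffun 'I_N -> int} :=
  (a.1 * b.1, [ffun j => a.2 j + b.2 j]).
exists [seq mm a b | a <- p, b <- r] => z z0.
rewrite -pf // -rg // /leval big_allpairs_dep /= mulr_suml.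
apply: eq_bigr => a _; rewrite mulr_sumr; apply: eq_bigr => b _ /=.
rewrite mulrACA -big_split /=; congr (_ * _); apply: eq_bigr => j _.
by rewrite ffunE expfzDr.
Qed.

Lemma islaurentX N (f : ('I_N -> C) -> C) n :
  islaurent f -> islaurent (fun z => f z ^+ n).
Proof.
move=> fL; elim: n => [|n IH]; first exact: islaurent_const.
have [p Hp] := islaurentM fL IH.
by exists p => z z0; rewrite Hp // exprS.
Qed.

Lemma islaurent_sum N (I : Type) (r : seq I) (P : pred I)
    (F : I -> ('I_N -> C) -> C) :
  (forall i, islaurent (F i)) -> islaurent (fun z => \sum_(i <- r | P i) F i z).
Proof.
move=> FL; elim: r => [|i r IH].
  have [p Hp] := islaurent_const N 0.
  by exists p => z z0; rewrite Hp // big_nil.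
case Pi: (P i); last first.
  by case: IH => p Hp; exists p => z z0; rewrite Hp // big_cons Pi.
have [p Hp] := islaurentD (FL i) IH.
by exists p => z z0; rewrite Hp // big_cons Pi.
Qed.

Lemma islaurent_prod N (I : Type) (r : seq I) (F : I -> ('I_N -> C) -> C) :
  (forall i, islaurent (F i)) -> islaurent (fun z => \prod_(i <- r) F i z).
Proof.
move=> FL; elim: r => [|i r IH].
  have [p Hp] := islaurent_const N 1.
  by exists p => z z0; rewrite Hp // big_nil.
have [p Hp] := islaurentM (FL i) IH.
by exists p => z z0; rewrite Hp // big_cons.
Qed.

Lemma islaurent_det N (A : 'I_N -> 'I_N -> ('I_N -> C) -> C) :
  (forall i j, islaurent (A i j)) ->
  islaurent (fun z => \det (\matrix_(i, j) A i j z)).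
Proof.
move=> AL; rewrite /determinant.
have [|p Hp] := @islaurent_sum N _ (index_enum _) predT
    (fun s : {perm 'I_N} => fun z => (-1) ^+ s * \prod_i A i (s i) z).
  by move=> s; apply: islaurentM; [exact: islaurent_const|exact: islaurent_prod].
exists p => z z0; rewrite Hp //; apply: eq_bigr => s _; congr (_ * _).
by apply: eq_bigr => i _; rewrite mxE.
Qed.

Lemma entryP G (n : nat) : exists p : {poly C}, forall z, z != 0 ->
  entry_den G z != 0 -> entry_num G n%:Z z / entry_den G z = p.[z + z^-1].
Proof.
suff [p [r [Hp Hr]]] : exists p r : {poly C},
    (forall z, z != 0 -> entry_den G z != 0 ->
       entry_num G n%:Z z / entry_den G z = p.[z + z^-1]) /\
    (forall z, z != 0 -> entry_den G z != 0 ->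
       entry_num G n.+1%:Z z / entry_den G z = r.[z + z^-1]) by exists p.
elim: n => [|n [p [r [Hp Hr]]]]; last first.
  exists r, ('X * r - p); split=> // z z0 d0.
  rewrite !hornerE -Hr // -Hp // mulrA -mulrBl; congr (_ / _).
  have pw (w : C) (a b : int) : w != 0 ->
      (w ^ a + w ^ (- a)) * w ^ b = w ^ (b + a) + w ^ (b - a).
    by move=> w0; rewrite mulrDl -!expfzDr // ![_ + b]addrC.
  have z1 : z + z^-1 = z ^ (1 : int) + z ^ (- (1 : int)).
    by rewrite expr1z exprN1.
  case: G {Hp Hr d0} => /=.
  - have s0 : sqrtC z != 0 by rewrite sqrtC_eq0.
    have -> : z + z^-1 = sqrtC z ^ (2 : int) + sqrtC z ^ (- (2 : int)).
      by rewrite -invr_expz -exprnP sqrtCK.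
    rewrite [X in _ = X - _]mulrBr !pw //.
    rewrite [2 * n.+1%:Z + 1 + _](_ : _ = 2 * n.+2%:Z + 1); last by lia.
    rewrite [2 * n.+1%:Z + 1 - _](_ : _ = 2 * n%:Z + 1); last by lia.
    rewrite [- (2 * n.+1%:Z + 1) + _](_ : _ = - (2 * n%:Z + 1)); last by lia.
    rewrite [- (2 * n.+1%:Z + 1) - _](_ : _ = - (2 * n.+2%:Z + 1)); last by lia.
    ring.
  - rewrite z1 [X in _ = X - _]mulrBr !pw //.
    rewrite [n.+1%:Z + 1 + _](_ : _ = n.+2%:Z + 1); last by lia.
    rewrite [n.+1%:Z + 1 - _](_ : _ = n%:Z + 1); last by lia.
    rewrite [- (n.+1%:Z + 1) + _](_ : _ = - (n%:Z + 1)); last by lia.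
    rewrite [- (n.+1%:Z + 1) - _](_ : _ = - (n.+2%:Z + 1)); last by lia.
    ring.
  - rewrite z1 [X in _ = X - _]mulrDr !pw //.
    rewrite [n.+1%:Z + _](_ : _ = n.+2%:Z); last by lia.
    rewrite [n.+1%:Z - _](_ : _ = n%:Z); last by lia.
    rewrite [- n.+1%:Z + _](_ : _ = - n%:Z); last by lia.
    rewrite [- n.+1%:Z - _](_ : _ = - n.+2%:Z); last by lia.
    ring.
case: G => /=.
- exists 1, ('X + 1); split=> z z0 d0; rewrite !hornerE.
    by rewrite expr1z exprN1 divff.
  have s0 : sqrtC z != 0 by rewrite sqrtC_eq0.
  apply: (mulIf d0); rewrite mulfVK // /entry_num.
  move: (sqrtC z) (sqrtCK z) s0 {d0} => s zs s0.
  rewrite -zs -[_ ^ (2 + 1)]/(s ^+ 3) -[_ ^ (- (2 + 1))]/(s ^- 3).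
  by field.
- exists 1, 'X; split=> z z0 d0; rewrite !hornerE.
    by rewrite expr1z exprN1 divff.
  apply: (mulIf d0); rewrite mulfVK //.
  rewrite -[_ ^ (1 + 1)]/(z ^+ 2) -[_ ^ (- (1 + 1))]/(z ^- 2).
  by field.
- exists (2%:P), 'X; split=> z z0 d0; rewrite !hornerE divr1.
    by rewrite oppr0 expr0z.
  by rewrite expr1z exprN1.
Qed.

Section DividedDifferences.
Variables (M : nat) (t : nat -> C).

Definition dd_eval (c : nat -> C) (x : C) : C := \sum_(j < M) c j * x ^+ j.

Fixpoint dd (c : nat -> C) (m : nat) : nat -> C :=
  if m is m'.+1 then
    fun i => - \sum_(j < M | (i < j)%N) dd c m' j * t m' ^+ (j - i.+1)
  else c.

Lemma ddS c m x :
  dd_eval (dd c m) x = dd_eval (dd c m) (t m) + (t m - x) * dd_eval (dd c m.+1) x.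
Proof.
apply/eqP; rewrite addrC -subr_eq -sumrB; apply/eqP.
transitivity (\sum_(j < M) \sum_(i < M | (i < j)%N)
    (t m - x) * - (dd c m j * t m ^+ (j - i.+1) * x ^+ i)).
  apply: eq_bigr => j _; rewrite -mulrBr -opprB subrXX mulrN mulrCA -mulrN.
  rewrite -mulr_sumr sumrN mulr_sumr; congr (_ * - _).
  rewrite (big_ord_widen M
    (fun i => dd c m j * (t m ^+ (j.-1 - i) * x ^+ i)) (ltnW (ltn_ord j))).
  by apply: eq_bigr => i _; rewrite mulrA subnS predn_sub.
rewrite (exchange_big_dep xpredT) //= /dd_eval mulr_sumr; apply: eq_bigr => i _.
by rewrite -mulr_sumr sumrN mulNr mulr_suml.
Qed.

Lemma dd_newton c n x :
  dd_eval c x = \sum_(m < n) dd_eval (dd c m) (t m) * \prod_(l < m) (t l - x)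
           + dd_eval (dd c n) x * \prod_(l < n) (t l - x).
Proof.
elim: n => [|n IH]; first by rewrite !big_ord0 add0r mulr1.
rewrite {}IH !big_ord_recr /= [in LHS]ddS mulrDl addrA; congr (_ + _).
by rewrite [_ * (_ - x)]mulrC mulrCA mulrA.
Qed.

End DividedDifferences.

Lemma dd_laurent N M (t : nat -> ('I_N -> C) -> C) (c : nat -> C) m i :
  (forall n, islaurent (t n)) ->
  islaurent (fun z => dd M (t ^~ z) c m i).
Proof.
move=> tL; elim: m i => [|m IH] i; first exact: islaurent_const.
have := @islaurent_sum N _ (index_enum 'I_M) (fun j : 'I_M => (i < j)%N)
  (fun j z => - 1 * (dd M (t ^~ z) c m j * t m z ^+ (j - i.+1))).
case=> [j|p Hp].
  apply: islaurentM; first exact: islaurent_const.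
  by apply: islaurentM; [exact: IH|exact: islaurentX].
by exists p => z z0; rewrite Hp //= -mulr_sumr mulN1r.
Qed.

Lemma is_chi_exists G N (lam : 'I_N -> int) :
  GTplus lam -> exists p, is_chi G lam p.
Proof.
case=> _ lam0.
have l0 (i : 'I_N) : exists l : nat, lam i + (N%:Z - i.+1%:Z) = l%:Z.
  exists `|(lam i + (N%:Z - i.+1%:Z))%R|%N.
  by have := lam0 i; have := ltn_ord i; lia.
have /choice[P HP] (i : 'I_N) : exists p : {poly C}, forall z, z != 0 ->
    entry_den G z != 0 ->
    entry_num G (lam i + (N%:Z - i.+1%:Z)) z / entry_den G z = p.[z + z^-1].
  by have [l ->] := l0 i; exact: entryP.
pose M := \max_(i < N) size (P i).
pose t (n : nat) (z : 'I_N -> C) : C :=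
  if insub n is Some j then z j + (z j)^-1 else 0.
have tE (j : 'I_N) z : t j z = z j + (z j)^-1 by rewrite /t valK.
have tL n : islaurent (t n).
  rewrite /t; case: insubP => [j _ _|_]; last exact: islaurent_const.
  have [p Hp] := islaurentD (islaurent_exp j 1) (islaurent_exp j (- 1)).
  by exists p => z z0; rewrite Hp // expr1z exprN1.
pose D (i m : 'I_N) z := dd_eval M (dd M (t ^~ z) (fun n => (P i)`_n) m) (t m z).
have DL i m : islaurent (D i m).
  apply: (@islaurent_sum N _ (index_enum 'I_M) xpredT (fun j z =>
    dd M (t ^~ z) (fun n => (P i)`_n) m j * t m z ^+ j)) => j.
  by apply: islaurentM; [exact: dd_laurent|exact: islaurentX].
have [p Hp] := islaurent_det DL; exists p => z [z0 d0 V0]; rewrite Hp //.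
apply: (mulfI V0); rewrite mulVKf //.
pose U : 'M[C]_N := \matrix_(m, j) \prod_(l < m) (t l z - t j z).
have -> : \matrix_(i, j)
    (entry_num G (lam i + (N%:Z - i.+1%:Z)) (z j) / entry_den G (z j))
    = (\matrix_(i, j) D i j z) *m U.
  apply/matrixP => i j; rewrite !mxE HP // -tE.
  have -> : (P i).[t j z] = dd_eval M (fun n => (P i)`_n) (t j z).
    by apply: horner_coef_wide; exact: (leq_bigmax i).
  rewrite (dd_newton _ (t ^~ z) _ N) [X in _ + _ * X](bigD1 j) //= subrr mul0r.
  by rewrite mulr0 addr0; apply: eq_bigr => m _; rewrite !mxE.
rewrite det_mulmx mulrC; congr (_ * _).
rewrite -det_tr det_trig; last first.
  apply/is_trig_mxP => j m jm; rewrite !mxE (bigD1 (Ordinal jm)) //=.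
  by rewrite subrr mul0r.
rewrite /Vs (exchange_big_dep xpredT) //=; apply: eq_bigr => j _; rewrite !mxE.
rewrite (big_ord_widen N (fun l => t l z - t j z) (ltnW (ltn_ord j))).
by apply: eq_bigr => l _; rewrite !tE opprD addrA.
Qed.

Lemma is_chi_chi_poly G N (lam : 'I_N -> int) :
  GTplus lam -> is_chi G lam (chi_poly G lam).
Proof.
move=> /(is_chi_exists G)[p Hp].
exact: (xgetPex [::] (ex_intro _ p Hp)).
Qed.

End Defs.

(* Main.v *)
Require Import Defs.
From HB Require Import structures.
From mathcomp Require Import all_boot all_order all_algebra.
From mathcomp Require Import all_classical all_reals all_analysis.
From mathcomp Require Import complex.
From mathcomp Require Import zify ring lra.

Import Order.TTheory GRing.Theory Num.Theory.
Import numFieldNormedType.Exports.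

Set Implicit Arguments.
Unset Strict Implicit.
Unset Printing Implicit Defensive.

Local Open Scope classical_set_scope.
Local Open Scope ring_scope.

(** The identity is Cramer's rule in disguise. Write t(z) = z + 1/z, so that the
    product Vs is the Vandermonde product in the t(z_j), and let A be the square
    matrix of the determinant that defines chi, evaluated at the points
    b_l = q^(l + eps). Replacing the first k columns of A by columns v_1, .., v_k
    multiplies the determinant by the k x k minor of A^-1 v in its first k rows; by
    Cramer's rule the entries of that minor are the determinants with one column
    replaced, divided by det A (det_subst_cols). With v_i the column at x_i this
    expresses chi(x_1, .., x_k, b_k, ..) by the values of chi at the b_l with a
    single b_j replaced by x_i, up to Vandermonde products (det_ratio_interp).

    In the entry (i, j) the Vandermonde products contribute
    prod_(l <> j) (t(b_j) - t(b_l)) / (t(x_i) - t(b_l)). The factors with l >= k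
    split into a row factor and a column factor and leave the determinant. For
    l < k the denominators cancel against the q-Pochhammer symbols, because
    (1 - b y) (1 - b / y) = b (t(b) - t(y)) makes these symbols equal to
    prod_(l < k, l <> j) b_l (t(b_l) - t(y)) (qweightE). Comparing constants, it
    remains to see that 1 / c_(k,N) is the product over j of these expressions at
    y = b_j (ckN_qweight); in particular it does not depend on N.

    This argument divides by Vandermonde products, hence it needs points x in
    general position (generic_identity). The identity times Vs(x) has continuous
    sides on nonzero x, so it extends to all of them by moving x along a line
    that meets the exceptional set in isolated points only (cleared_identity).
    Dividing by Vs(x), or using the continuity of chi where Vs(x) = 0, gives the
    theorem. *)

(** * Replacing columns in a determinant *)

Section CramerRule.
Variable F : fieldType.

Definition subst_col n (A : 'M[F]_n) (j : 'I_n) (v : 'cV[F]_n) : 'M[F]_n :=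
  \matrix_(i, l) if l == j then v i 0 else A i l.

(** Cramer's rule: the cofactors along column j do not see the entries of that
    column, so the adjugate of A serves for the modified matrix as well. *)
Lemma adj_mul_col n (A : 'M[F]_n) (v : 'cV[F]_n) j :
  (\adj A *m v) j 0 = \det (subst_col A j v).
Proof.
rewrite (expand_det_col _ j) !mxE; apply: eq_bigr => i _.
rewrite !mxE eqxx mulrC; congr (_ * (_ * \det _)).
by apply/matrixP => a b; rewrite !mxE eq_sym (negPf (neq_lift _ _)).
Qed.

(** Multiplying by A^-1 turns the retained columns of A into unit columns, so the
    determinant reduces to the minor given by the first k rows of A^-1 v. *)
Lemma det_subst_cols k m (A : 'M[F]_(k + m)) (v : 'M[F]_(k + m, k)) :
  \det A != 0 ->
  \det (row_mx v (rsubmx A)) = \det A * \det (\matrix_(i < k, j < k)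
    (\det (subst_col A (lshift m j) (col i v)) / \det A)).
Proof.
move=> A0; have Au : A \in unitmx by rewrite unitmxE unitfE.
pose W := invmx A *m v.
have -> : row_mx v (rsubmx A) = A *m block_mx (usubmx W) 0 (dsubmx W) 1%:M.
  rewrite -[A in RHS]hsubmxK -[v](mulKVmx Au) -/W -{1}[A]hsubmxK -{1}[W]vsubmxK.
  by rewrite mul_row_block mul_row_col mulmx0 mulmx1 add0r.
rewrite det_mulmx det_lblock det1 mulr1 -(det_tr (usubmx W)); congr (_ * \det _).
have WE : W = (\det A)^-1 *: (\adj A *m v) by rewrite /W /invmx Au scalemxAl.
apply/matrixP => i j; rewrite [RHS]mxE -adj_mul_col WE !mxE mulrC.
by congr (_ * _); apply: eq_bigr => l _; rewrite !mxE.
Qed.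

End CramerRule.

(** * Vandermonde products and the interpolation identity *)

Section Vandermonde.
Variable F : fieldType.

Definition vprod n (t : 'I_n -> F) : F :=
  \prod_(i < n) \prod_(j < n | (i < j)%N) (t i - t j).

Lemma eq_vprod n (s t : 'I_n -> F) : s =1 t -> vprod s = vprod t.
Proof. by move=> e; do 2!apply: eq_bigr => ? _; rewrite !e. Qed.

Lemma vprod_cat k m (t : 'I_(k + m) -> F) :
  vprod t = vprod (t \o lshift m)
    * (\prod_(i < k) \prod_(l < m) (t (lshift m i) - t (rshift k l)))
    * vprod (t \o @rshift k m).
Proof.
rewrite /vprod big_split_ord /=; congr (_ * _).
  rewrite -big_split /=; apply: eq_bigr => i _.
  rewrite big_split_ord /=; congr (_ * _); apply: eq_bigl => l.
  by rewrite (leq_trans (ltn_ord i)) ?leq_addr.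
apply: eq_bigr => i _; rewrite big_split_ord /= big_pred0 ?mul1r => [|l].
  by apply: eq_bigl => l; rewrite ltn_add2l.
by rewrite ltnNge (leq_trans (ltnW (ltn_ord l))) ?leq_addr.
Qed.

Definition subst_pt n (t : 'I_n -> F) (j : 'I_n) (y : F) : 'I_n -> F :=
  fun l => if l == j then y else t l.

(** Isolating the factors that involve t_j. The remaining product is free of t_j,
    and the signs depend on the index l only: both cancel when t_j is replaced. *)
Lemma vprod_split n (t : 'I_n -> F) j :
  vprod t = (\prod_(l < n | l != j) ((-1) ^+ (l < j)%N * (t j - t l)))
    * \prod_(i < n | i != j) \prod_(l < n | l != j)
        (if (i < l)%N then t i - t l else 1).
Proof.
rewrite /vprod.
under eq_bigr => i _ do rewrite big_mkcond (bigD1 j) //=.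
rewrite (bigD1 j) //= ltnn mul1r big_split /= mulrA -big_split /=.
congr (_ * _); apply: eq_bigr => l lj.
case: ltngtP => [||e]; rewrite ?mul1r ?mulr1 ?expr0 // ?expr1 ?mulN1r ?opprB //.
by rewrite (val_inj e) eqxx in lj.
Qed.

Lemma vprod_subst n (t : 'I_n -> F) j y :
  vprod (subst_pt t j y) * \prod_(l < n | l != j) (t j - t l)
  = vprod t * \prod_(l < n | l != j) (y - t l).
Proof.
rewrite !(vprod_split _ j) !big_split /= -!mulrA; congr (_ * _).
rewrite [X in X * (_ * _) = _](eq_bigr (fun l => y - t l)) => [|l lj]; last first.
  by rewrite /subst_pt eqxx (negPf lj).
rewrite mulrA [RHS]mulrA -mulrA [RHS]mulrC; congr (_ * _).
rewrite mulrC; congr (_ * _).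
apply: eq_bigr => i /negPf ij; apply: eq_bigr => l /negPf lj.
by rewrite /subst_pt ij lj.
Qed.

Lemma vprod_neq0 n (t : 'I_n -> F) : injective t -> vprod t != 0.
Proof.
move=> tI; apply/prodf_neq0 => i _; apply/prodf_neq0 => j ij.
by rewrite subr_eq0 (inj_eq tI) -val_eqE neq_ltn ij.
Qed.

Lemma det_scale_rows_cols n (A : 'M[F]_n) (r c : 'I_n -> F) :
  \det (\matrix_(i, j) (A i j * (r i * c j)))
  = (\prod_i r i) * \det A * \prod_j c j.
Proof.
transitivity (\det (diag_mx (\row_i r i) *m A *m diag_mx (\row_j c j))).
  rewrite mul_diag_mx mul_mx_diag; congr (\det _).
  by apply/matrixP => i j; rewrite !mxE; ring.
rewrite !det_mulmx !det_diag; congr (_ * _ * _);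
  by apply: eq_bigr => i _; rewrite mxE.
Qed.

(** The algebraic core of the theorem, with arbitrary nodes t, points y and weights
    g: a quotient of alternants by Vandermonde products, as chi is, at k new points
    is a determinant of such quotients at one new point each. The factors of the
    Vandermonde products that pair a new point with a node t_l, l >= k, depend on
    the row only and come out of the determinant; those with l < k are cancelled
    by the numerators t_l - y_i. The weights cancel out and serve to match the
    q-Pochhammer symbols. If det A = 0, both sides vanish because k > 0. *)
Lemma det_ratio_interp k m (A : 'M[F]_(k + m)) (v : 'M[F]_(k + m, k))
    (t s : 'I_(k + m) -> F) (y g : 'I_k -> F) :
  (0 < k)%N -> injective t -> injective y -> (forall i l, y i != t l) ->
  (forall l, g l != 0) ->
  (forall i, s (lshift m i) = y i) ->
  (forall l, s (rshift k l) = t (rshift k l)) ->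
  (\det (row_mx v (rsubmx A)) / vprod s) / (\det A / vprod t)
  = (\prod_(j < k) \prod_(l < k | l != j)
       (g l * (t (lshift m l) - t (lshift m j))))^-1
    * (vprod (t \o lshift m) / vprod y)
    * \det (\matrix_(i < k, j < k)
        (\det (subst_col A (lshift m j) (col i v))
           / vprod (subst_pt t (lshift m j) (y i)) / (\det A / vprod t)
         * \prod_(l < k | l != j) (g l * (t (lshift m l) - y i)))).
Proof.
move=> k0 tI yI yt g0 sy st.
have [A0|A0] := eqVneq (\det A) 0.
  rewrite A0 mul0r invr0 mulr0.
  have det0k n : (0 < n)%N -> \det (0 : 'M[F]_n) = 0 by case: n => // n _; exact: det0.
  rewrite [X in \det X](_ : _ = 0) ?det0k ?mulr0 //.
  by apply/matrixP => i j; rewrite !mxE mulr0 mul0r.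
have t0 := vprod_neq0 tI; have y0 := vprod_neq0 yI.
pose D := \matrix_(i < k, j < k)
  (\det (subst_col A (lshift m j) (col i v)) / \det A).
(* r and c are the row and column factors to be pulled out of the determinant. *)
pose r i := \prod_(l < m) (y i - t (rshift k l))^-1.
pose c j := (\prod_(l < k | l != j) (g l * (t (lshift m l) - t (lshift m j))))
  * \prod_(l < m) (t (lshift m j) - t (rshift k l)).
have -> : \matrix_(i < k, j < k)
        (\det (subst_col A (lshift m j) (col i v))
           / vprod (subst_pt t (lshift m j) (y i)) / (\det A / vprod t)
         * \prod_(l < k | l != j) (g l * (t (lshift m l) - y i)))
   = \matrix_(i, j) (D i j * (r i * c j)).
  apply/matrixP => i j; rewrite !mxE.
  have := vprod_subst t (lshift m j) (y i).
  set V := vprod (subst_pt _ _ _); rewrite !big_split_ord /=.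
  have lsE (l : 'I_k) : (lshift m l != lshift m j) = (l != j).
    by rewrite (inj_eq (@lshift_inj _ _)).
  have rsE (l : 'I_m) : (rshift k l != lshift m j).
    by rewrite eq_sym eq_lrshift.
  rewrite !(eq_bigl _ _ lsE) !(eq_bigl _ _ rsE).
  set P1 := \prod_(_ < k | _) _; set P2 := \prod_(_ < m) _.
  set Q1 := \prod_(_ < k | _) _; set Q2 := \prod_(_ < m) _ => E.
  have Q10 : Q1 != 0 by apply/prodf_neq0 => l _; rewrite subr_eq0.
  have Q20 : Q2 != 0 by apply/prodf_neq0 => l _; rewrite subr_eq0.
  have P10 : P1 != 0.
    by apply/prodf_neq0 => l lj; rewrite subr_eq0 (inj_eq tI) eq_sym lsE.
  have P20 : P2 != 0 by apply/prodf_neq0 => l _; rewrite subr_eq0 (inj_eq tI) eq_sym.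
  have V0 : V != 0.
    apply/eqP => V0; have := mulf_neq0 t0 (mulf_neq0 Q10 Q20).
    by rewrite -E V0 mul0r eqxx.
  have -> : \prod_(l < k | l != j) (g l * (t (lshift m l) - y i))
      = (\prod_(l < k | l != j) - g l) * Q1.
    by rewrite -big_split; apply: eq_bigr => l _ /=; ring.
  have -> : r i = Q2^-1 by rewrite -prodfV.
  have -> : c j = (\prod_(l < k | l != j) - g l) * P1 * P2.
    by rewrite /c -big_split; congr (_ * _); apply: eq_bigr => l _ /=; ring.
  have -> : vprod t = V * (P1 * P2) / (Q1 * Q2) by rewrite E mulfK ?mulf_neq0.
  by field; rewrite ?A0 ?V0 ?P10 ?P20 ?Q10 ?Q20.
rewrite det_scale_rows_cols det_subst_cols // -/D.
rewrite /c big_split /=.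
set G := \prod_(j < k) \prod_(l < k | _) _.
have G0 : G != 0.
  apply/prodf_neq0 => j _; apply/prodf_neq0 => l lj; rewrite mulf_neq0 //.
  by rewrite subr_eq0 (inj_eq tI) (inj_eq (@lshift_inj _ _)).
have -> : vprod s = vprod y * (\prod_i r i)^-1 * vprod (t \o @rshift k m).
  rewrite vprod_cat; congr (_ * _ * _); [exact: eq_vprod| |exact: eq_vprod].
  rewrite -prodfV; apply: eq_bigr => i _; rewrite /r prodfV invrK.
  by apply: eq_bigr => l _; rewrite sy st.
have /prodf_neq0 r0 : forall i, true -> r i != 0.
  by move=> i _; apply/prodf_neq0 => l _; rewrite invr_eq0 subr_eq0.
move: t0; rewrite [vprod t]vprod_cat !mulf_eq0 !negb_or => /andP[/andP[t10 t20] t30].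
by field; rewrite ?A0 ?G0 ?y0 ?r0 ?t10 ?t20 ?t30.
Qed.

End Vandermonde.

(** * The variable z + 1/z, powers of q and q-Pochhammer symbols *)

(** The functions Vs and chi, invariant under z_j -> 1 / z_j, are functions of this
    coordinate. *)
Definition symm (F : fieldType) (z : F) : F := z + z^-1.

Lemma symm_eq (F : fieldType) (z w : F) : z != 0 -> w != 0 ->
  (symm z == symm w) = (z == w) || (z * w == 1).
Proof.
move=> z0 w0; rewrite -(inj_eq (mulIf (mulf_neq0 z0 w0))) -subr_eq0.
rewrite -[z == w]subr_eq0 -[z * w == 1]subr_eq0 -mulf_eq0; congr (_ == 0).
by rewrite /symm; field; rewrite z0 w0.
Qed.

(** This turns a pair of q-Pochhammer factors into a difference of nodes. *)
Lemma symm_factor (F : fieldType) (b y : F) : b != 0 -> y != 0 ->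
  b * (b + b^-1 - (y + y^-1)) = (1 - b * y) * (1 - b / y).
Proof. by move=> b0 y0; field; rewrite b0 y0. Qed.

Lemma prod_ord_skip (R : comNzRingType) k (j : 'I_k) (F : nat -> R) :
  \prod_(l < k | l != j) F l
  = (\prod_(l < j) F l) * \prod_(l < k - j.+1) F (j.+1 + l)%N.
Proof.
rewrite -(big_mkord (fun l => l != j :> nat) F).
rewrite (@big_cat_nat _ _ _ j) ?(ltnW (ltn_ord j)) //=.
rewrite [X in _ * X]big_ltn_cond ?ltn_ord // eqxx /=; congr (_ * _).
  rewrite big_nat_cond (eq_bigl (fun l => (0 <= l < j)%N)) => [|l]; last first.
    by case: ltngtP; rewrite ?andbF.
  by rewrite -big_nat big_mkord.
rewrite -{1}[j.+1]add0n big_addn (eq_bigl xpredT) => [|l].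
  by rewrite big_mkord; apply: eq_bigr => l _; rewrite addnC.
by apply/eqP; lia.
Qed.

Section QPowers.
Variables (R : realType) (q : R).
Hypotheses (q0 : 0 < q) (q1 : q < 1).
Local Notation C := R[i].

Lemma qpowD (r s : R) : qpow q (r + s) = qpow q r * qpow q s.
Proof. by rewrite /qpow powRD ?(gt_eqF q0) ?implybT // rmorphM. Qed.

Lemma qpow_nat n : qpow q n%:R = q%:C%C ^+ n.
Proof. by rewrite /qpow powR_mulrn ?(ltW q0) // rmorphXn. Qed.

Lemma qpow_neq0 (r : R) : qpow q r != 0.
Proof.
rewrite /qpow (_ : 0 = 0%:C%C) // (inj_eq (@complexI _)).
by rewrite gt_eqF ?powR_gt0.
Qed.

Lemma qpowN (r : R) : qpow q (- r) = (qpow q r)^-1.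
Proof. by rewrite /qpow powRN fmorphV. Qed.

Lemma qpow_neq1 (r : R) : r != 0 -> qpow q r != 1.
Proof.
move=> r0; rewrite /qpow (_ : 1 = 1%:C%C) // (inj_eq (@complexI _)).
rewrite /powR (gt_eqF q0) -expR0 (inj_eq (@expR_inj _)) mulf_neq0 //.
by rewrite lt_eqF // ln_lt0 // q0 q1.
Qed.

Lemma qpow_inj (r s : R) : qpow q r = qpow q s -> r = s.
Proof.
move=> e; apply/eqP; rewrite -subr_eq0; apply/negPn/negP.
by move=> /qpow_neq1; rewrite qpowD qpowN e divff ?eqxx ?qpow_neq0.
Qed.

Lemma qpochE n (s : seq C) :
  qpoch q n s = \prod_(a <- s) \prod_(i < n) (1 - a * q%:C%C ^+ i).
Proof. by apply: eq_bigr => a _; rewrite big_add1 /= big_mkord. Qed.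

Lemma qpoch2 n (a b : C) : qpoch q n [:: a; b] = qpoch q n [:: a] * qpoch q n [:: b].
Proof. by rewrite /qpoch !big_cons !big_nil !mulr1. Qed.

Lemma qpoch_cat n m (r : R) : qpoch q (n + m) [:: qpow q r]
  = qpoch q n [:: qpow q r] * qpoch q m [:: qpow q (r + n%:R)].
Proof.
rewrite !qpochE !big_seq1 big_split_ord /=; congr (_ * _); apply: eq_bigr => i _.
by rewrite qpowD qpow_nat -mulrA -exprD.
Qed.

Lemma qpoch_neq0 n (r : R) : (forall i, (i < n)%N -> r + i%:R != 0) ->
  qpoch q n [:: qpow q r] != 0.
Proof.
move=> H; rewrite qpochE big_seq1; apply/prodf_neq0 => i _.
by rewrite -qpow_nat -qpowD subr_eq0 eq_sym qpow_neq1 ?H.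
Qed.

Lemma eps_ge0 G : 0 <= eps R G.
Proof. by case: G => //=; rewrite invr_ge0. Qed.

(** The q-Pochhammer factors in the entries of the determinant of the theorem. *)
Definition qweight G k j (y : C) : C :=
  qpoch q j [:: qpow q (eps R G) * y; qpow q (eps R G) / y]
  * qpoch q (k - j.+1) [:: qpow q (j.+1%:R + eps R G) * y;
                           qpow q (j.+1%:R + eps R G) / y].

(** Writing b_l = q^(l + eps), the two symbols run over the l < k below and above j,
    so that in the variable y + 1/y their product is, up to scaling, the Lagrange
    basis polynomial of the node b_j + 1 / b_j among the first k nodes. *)
Lemma qweightE G k (j : 'I_k) (y : C) : y != 0 ->
  qweight G k j y = \prod_(l < k | l != j) (qpts G q l
    * (qpts G q l + (qpts G q l)^-1 - (y + y^-1))).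
Proof.
move=> y0.
pose F l := (1 - qpow q (l%:R + eps R G) * y) * (1 - qpow q (l%:R + eps R G) / y).
transitivity (\prod_(l < k | l != j) F l); last first.
  by apply: eq_bigr => l _; rewrite /qpts symm_factor ?qpow_neq0.
rewrite prod_ord_skip /qweight !qpochE !big_cons !big_nil !mulr1 -!big_split /=.
congr (_ * _); apply: eq_bigr => l _; rewrite /F ?natrD !qpowD !qpow_nat.
  by congr ((1 - _) * (1 - _)); rewrite [_ ^+ _ * _]mulrC mulrAC.
by congr ((1 - _) * (1 - _)); rewrite mulrAC; congr (_ * _); exact: mulrAC.
Qed.

(** In c_(k,N), with i = j + 1, the symbols of length i - 1 are the first pair in
    qweight at y = b_j. Those of length N - i split into a head of length k - i,
    which is the second pair, and a tail of length N - k. The tails cancel with the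
    numerator: one of them factor by factor, the one of (q; q)_(N - i) only in the
    product over i, after the reversal i -> k + 1 - i. *)
Lemma ckN_qweight G k N : (k <= N)%N ->
  ckN G q k N * \prod_(j < k) qweight G k j (qpts G q j) = 1.
Proof.
move=> kN; have e0 := eps_ge0 G.
rewrite /ckN big_add1 /= big_mkord -big_split /=.
transitivity (\prod_(j < k) (qpoch q (N - k) [:: qpow q j.+1%:R]
    / qpoch q (N - k) [:: qpow q (k - j)%:R])); last first.
  rewrite big_split /= prodfV [X in X / _](reindex_inj rev_ord_inj) /=.
  rewrite (eq_bigr (fun i : 'I_k => qpoch q (N - k) [:: qpow q (k - i)%:R])).
    rewrite divff //; apply/prodf_neq0 => j _; apply: qpoch_neq0 => i _.
    by rewrite -natrD pnatr_eq0; have := ltn_ord j; lia.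
  by move=> i _; rewrite subnSK.
apply: eq_bigr => j _; rewrite /qweight !qpoch2 /qpts.
have jk := ltn_ord j.
rewrite -!qpowD -!qpowN -!qpowD.
set e := eps R G in e0 *.
rewrite [k%:R + _ - 1 + _](_ : _ = (2 * j.+1%:R - 1 + 2 * e) + (k - j.+1)%:R);
  last first.
  by rewrite natrB // -!natr1; ring.
rewrite (_ : (N - j.+1 = (k - j.+1) + (N - k))%N); last by lia.
rewrite !qpoch_cat.
rewrite [1 + (k - _)%:R](_ : _ = (k - j)%:R); last first.
  by rewrite nat1r; congr _%:R; lia.
rewrite [j.+1%:R - 1 + 2 * e](_ : _ = e + (j%:R + e)); last by rewrite -natr1; ring.
rewrite [1 - j.+1%:R](_ : _ = e + - (j%:R + e)); last by rewrite -natr1; ring.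
rewrite [2 * j.+1%:R - 1 + 2 * e](_ : _ = j.+1%:R + e + (j%:R + e)); last first.
  by rewrite -natr1; ring.
rewrite [j.+1%:R + e + - _](_ : _ = 1); last by rewrite -natr1; ring.
(* Division is legitimate as no exponent of q is zero: all are positive, except for
   the exponents i - j with i < j in n3. *)
have n1 : qpoch q (N - k) [:: qpow q (j.+1%:R + e + (j%:R + e) + (k - j.+1)%:R)] != 0.
  apply: qpoch_neq0 => i _; rewrite gt_eqF //.
  have := ler0n R j; have := ler0n R i; have := ler0n R (k - j.+1).
  by rewrite -natr1; lra.
have n2 : qpoch q j [:: qpow q (e + (j%:R + e))] != 0.
  apply: qpoch_neq0 => i ij; rewrite gt_eqF //.
  have : (1 : R) <= j%:R by rewrite ler1n; lia.
  by have := ler0n R i; lra.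
have n3 : qpoch q j [:: qpow q (e + - (j%:R + e))] != 0.
  apply: qpoch_neq0 => i ij; rewrite lt_eqF //.
  have : i%:R < j%:R :> R by rewrite ltr_nat.
  by lra.
have n4 : qpoch q (k - j.+1) [:: qpow q 1] != 0.
  by apply: qpoch_neq0 => i _; rewrite nat1r pnatr_eq0.
have n5 : qpoch q (N - k) [:: qpow q (k - j)%:R] != 0.
  by apply: qpoch_neq0 => i _; rewrite -natrD pnatr_eq0; lia.
have n6 : qpoch q (k - j.+1) [:: qpow q (j.+1%:R + e + (j%:R + e))] != 0.
  apply: qpoch_neq0 => i _; rewrite gt_eqF // -natr1.
  by have := ler0n R j; have := ler0n R i; lra.
have cancel (F : fieldType) (a b c d f g h : F) :
    b != 0 -> c != 0 -> d != 0 -> f != 0 -> g != 0 -> h != 0 ->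
    a * b / (c * d * (f * g * (h * b))) * (c * d * (h * f)) = a / g.
  by move=> *; field; do !(apply/andP; split).
exact: cancel.
Qed.

End QPowers.

(** * The identity for points in general position *)

Section GenericPoints.
Variables (R : realType) (q : R).
Hypotheses (q0 : 0 < q) (q1 : q < 1).
Local Notation C := R[i].

Lemma VsE n (z : 'I_n -> C) : Vs z = vprod (@symm R[i] \o z).
Proof.
by do 2!apply: eq_bigr => ? _; rewrite /symm /= opprD addrA.
Qed.

Lemma entry_den_neq0 G (z : C) : z != 0 -> G = GD \/ z ^+ 2 != 1 ->
  entry_den G z != 0.
Proof.
move=> z0 [->|z1]; first exact: oner_neq0.
have sub_inv_neq0 (w : C) : w != 0 -> w ^+ 2 != 1 -> w - w^-1 != 0.
  move=> w0; apply: contraNneq => /eqP; rewrite subr_eq0 => /eqP e.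
  by rewrite expr2 {1}e mulVf.
case: G => /=; [|exact: sub_inv_neq0|exact: oner_neq0].
apply: sub_inv_neq0; first by rewrite sqrtC_eq0.
by rewrite sqrtCK; apply: contraNneq z1 => ->; rewrite expr1n.
Qed.

Lemma qpts_neq0 G n (l : 'I_n) : qpts G q l != 0.
Proof. exact: qpow_neq0. Qed.

(** As 0 < q < 1, the points b_l are distinct, and b_l b_r = 1 would force
    l + r + 2 eps = 0, that is l = r = 0. *)
Lemma symm_qpts_inj G n : injective (@symm R[i] \o @qpts R G q n).
Proof.
move=> l r /eqP; rewrite /= symm_eq ?qpts_neq0 // => /orP[/eqP/(qpow_inj q0 q1)|].
  by move=> /addIr/eqP; rewrite eqr_nat => /eqP/val_inj.
rewrite /qpts -qpowD // => /eqP e; apply/val_inj/eqP; apply: contra_eqT e => /= lr.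
apply: qpow_neq1 => //; have := eps_ge0 R G.
have : (1 : R) <= l%:R + r%:R by rewrite -natrD ler1n; lia.
by move=> ? ?; rewrite gt_eqF //; lra.
Qed.

Lemma qpts_entry_den G n (l : 'I_n) : entry_den G (qpts G q l) != 0.
Proof.
apply: entry_den_neq0; first exact: qpts_neq0.
have pos : G = GD \/ 0 < eps R G.
  by case: G => /=; [right; rewrite invr_gt0|right|left].
case: pos => [->|e0]; [by left|right].
rewrite expr2 -qpowD // qpow_neq1 //.
by have := ler0n R l; move=> ?; rewrite gt_eqF //; lra.
Qed.

Lemma chiE G N (lam : 'I_N -> int) (z : 'I_N -> C) : GTplus lam -> chi_generic G z ->
  chi G lam z = chi_formula G lam z.
Proof. by move=> hlam; exact: (is_chi_chi_poly hlam). Qed.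

(** Conditions that keep the denominators of the determinantal formula nonzero at
    every point where the theorem evaluates chi; x_i ^ 2 <> 1 serves the entries in
    types B and C. *)
Definition generic_args G k (N : nat) (x : 'I_k -> C) : Prop :=
  [/\ forall i, x i != 0, forall i, x i ^+ 2 != 1,
      forall i (l : 'I_N), symm (x i) != symm (qpts G q l)
    & injective (@symm R[i] \o x)].

(** At generic points all values of chi are quotients of alternants by Vandermonde
    products, and det_ratio_interp applies with weights b_l. *)
Lemma generic_identity G k m (lam : 'I_(k + m) -> int) (x : 'I_k -> C) :
  (0 < k)%N -> GTplus lam -> generic_args G (k + m) x ->
  chi_lhs G q lam x = det_rhs G q lam x.
Proof.
move=> k0 hlam [x0 x1 xq xI].
pose T : 'I_(k + m) -> C := @symm R[i] \o @qpts R G q _.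
have TI : injective T := @symm_qpts_inj G _.
pose e (i : 'I_(k + m)) (z : C) : C :=
  entry_num G (lam i + ((k + m)%:Z - i.+1%:Z)) z / entry_den G z.
pose A := \matrix_(i, j) e i (qpts G q j) : 'M[C]_(k + m).
pose v := \matrix_(i < k + m, j < k) e i (x j).
have formulaE z : (forall j, z j != 0) -> (forall j, entry_den G (z j) != 0) ->
    injective (@symm R[i] \o z) ->
    chi G lam z = \det (\matrix_(i, j) e i (z j)) / vprod (@symm R[i] \o z).
  move=> z0 zd zI; rewrite chiE //; first by rewrite /chi_formula VsE mulrC.
  by split; rewrite // VsE vprod_neq0.
have xd i : entry_den G (x i) != 0 by apply: entry_den_neq0 => //; right.
have chi_q : chi G lam (@qpts R G q _) = \det A / vprod T.
  by apply: formulaE => [j|j|]; [exact: qpts_neq0|exact: qpts_entry_den|].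
pose s := @symm R[i] \o qpts_prefix G q x : 'I_(k + m) -> C.
have pre_l i : qpts_prefix G q x (lshift m i) = x i.
  by rewrite /qpts_prefix insubT //= => lk; congr x; exact: val_inj.
have pre_r (l : 'I_m) : qpts_prefix G q x (rshift k l) = qpts G q (rshift k l).
  by rewrite /qpts_prefix insubF //= ltnNge leq_addr.
have chi_p : chi G lam (qpts_prefix G q x) = \det (row_mx v (rsubmx A)) / vprod s.
  rewrite formulaE.
  - congr (\det _ / _); apply/matrixP => i j.
    by case: (split_ordP j) => l ->; rewrite ?row_mxEl ?row_mxEr !mxE ?pre_l ?pre_r.
  - move=> j; case: (split_ordP j) => l ->.
      by rewrite pre_l.
    by rewrite pre_r qpts_neq0.
  - move=> j; case: (split_ordP j) => l ->.
      by rewrite pre_l.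
    by rewrite pre_r qpts_entry_den.
  - move=> i j.
    case: (split_ordP i) => a ->; case: (split_ordP j) => b -> /=;
      rewrite ?pre_l ?pre_r => E.
    + by congr lshift; exact: xI.
    + by move: (xq a (rshift k b)); rewrite E eqxx.
    + by move: (xq b (rshift k a)); rewrite E eqxx.
    + exact: TI.
have chi_s (i j : 'I_k) : chi G lam (qpts_subst G q j (x i))
    = \det (subst_col A (lshift m j) (col i v))
      / vprod (subst_pt T (lshift m j) (symm (x i))).
  have subE l : qpts_subst G q j (x i) l
      = if l == lshift m j then x i else qpts G q l by [].
  rewrite formulaE.
  - congr (\det _ / _); last first.
      by apply: eq_vprod => l; rewrite /subst_pt /= subE; case: eqP.
    by apply/matrixP => a b; rewrite !mxE subE; case: eqP => // ->.
  - by move=> l; rewrite subE; case: ifP => _; [exact: x0|exact: qpts_neq0].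
  - by move=> l; rewrite subE; case: ifP => _; [exact: xd|exact: qpts_entry_den].
  - move=> a b; rewrite /= !subE; do 2!case: eqP => [->|_] //=.
    + by move=> E; move: (xq i b); rewrite E eqxx.
    + by move=> E; move: (xq i a); rewrite E eqxx.
    + exact: TI.
rewrite /chi_lhs /det_rhs chi_p chi_q.
have sl i : s (lshift m i) = symm (x i) by rewrite /s /= pre_l.
have sr l : s (rshift k l) = T (rshift k l) by rewrite /s /= pre_r.
rewrite (det_ratio_interp A v k0 TI xI xq (@qpts_neq0 G k) sl sr).
congr (_ * _ * _).
- apply: (mulfI (x := \prod_(j < k) qweight q G k j (qpts G q j))).
    have := ckN_qweight q0 q1 G (leq_addr m k).
    by apply: contra_eq_neq => ->; rewrite mulr0 eq_sym oner_neq0.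
  rewrite [RHS]mulrC ckN_qweight ?leq_addr //.
  under eq_bigr => j _ do rewrite qweightE ?qpts_neq0 //.
  rewrite divff //; apply/prodf_neq0 => j _; apply/prodf_neq0 => l lj.
  rewrite mulf_neq0 ?qpts_neq0 // subr_eq0.
  by rewrite (inj_eq (@symm_qpts_inj G k)).
- by rewrite !VsE.
- apply: (congr1 determinant); apply/matrixP => i j; rewrite !mxE chi_s.
  by rewrite -[RHS]mulrA; congr (_ * _); rewrite -/(qweight q G k j (x i)) qweightE.
Qed.

End GenericPoints.

(** * Continuity, and extension to all nonzero points *)

Section Continuity.
Variables (R : realType).
Local Notation C := R[i].
Variables (T : Type) (F : set_system T).
Context {FF : Filter F}.

Lemma cvg_bigsum (I : Type) (r : seq I) (f : I -> T -> C) (a : I -> C) :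
  (forall i, f i t @[t --> F] --> a i) ->
  \sum_(i <- r) f i t @[t --> F] --> \sum_(i <- r) a i.
Proof. by move=> fa; apply: cvg_big => //; exact: add_continuous. Qed.

Lemma cvg_bigprod (I : Type) (r : seq I) (P : pred I) (f : I -> T -> C) (a : I -> C) :
  (forall i, P i -> f i t @[t --> F] --> a i) ->
  \prod_(i <- r | P i) f i t @[t --> F] --> \prod_(i <- r | P i) a i.
Proof. by move=> fa; apply: cvg_big => //; exact: mul_continuous. Qed.

Lemma cvg_exprn (f : T -> C) (a : C) n :
  f t @[t --> F] --> a -> f t ^+ n @[t --> F] --> a ^+ n.
Proof.
move=> fa; rewrite -(card_ord n) -prodr_const.
under eq_fun do rewrite -prodr_const.
exact: cvg_bigprod.
Qed.

Lemma cvg_exprz (f : T -> C) (a : C) (n : int) : a != 0 ->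
  f t @[t --> F] --> a -> f t ^ n @[t --> F] --> a ^ n.
Proof.
move=> a0 fa; case: n => n; first exact: cvg_exprn.
by apply: cvgV; [rewrite expf_neq0|exact: cvg_exprn].
Qed.

Lemma cvg_leval N (p : laurent R N) (f : T -> 'I_N -> C) (a : 'I_N -> C) :
  (forall l, a l != 0) -> (forall l, f t l @[t --> F] --> a l) ->
  leval p (f t) @[t --> F] --> leval p a.
Proof.
move=> a0 fa; apply: cvg_bigsum => m; apply: cvgM; first exact: cvg_cst.
by apply: cvg_bigprod => l _; exact: cvg_exprz.
Qed.

Lemma cvg_det n (A : T -> 'M[C]_n) (B : 'M[C]_n) :
  (forall i j, A t i j @[t --> F] --> B i j) ->
  \det (A t) @[t --> F] --> \det B.
Proof.
move=> AB; apply: cvg_bigsum => s; apply: cvgM; first exact: cvg_cst.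
by apply: cvg_bigprod => i _; exact: AB.
Qed.

Lemma cvg_qpoch (q : R) n (f : T -> C) (a : C) :
  f t @[t --> F] --> a -> qpoch q n [:: f t] @[t --> F] --> qpoch q n [:: a].
Proof.
move=> fa; under eq_fun do rewrite qpochE big_seq1.
rewrite qpochE big_seq1; apply: cvg_bigprod => i _.
apply: cvgB; first exact: cvg_cst.
by apply: cvgM; [exact: fa|exact: cvg_cst].
Qed.

Lemma cvg_qweight (q : R) G k j (f : T -> C) (a : C) : a != 0 ->
  f t @[t --> F] --> a -> qweight q G k j (f t) @[t --> F] --> qweight q G k j a.
Proof.
move=> a0 fa; rewrite /qweight !qpoch2; under eq_fun do rewrite !qpoch2.
have aV := cvgV a0 fa.
apply: cvgM; apply: cvgM; apply: cvg_qpoch.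
- by apply: cvgM; [exact: cvg_cst|exact: fa].
- by apply: cvgM; [exact: cvg_cst|exact: aV].
- by apply: cvgM; [exact: cvg_cst|exact: fa].
- by apply: cvgM; [exact: cvg_cst|exact: aV].
Qed.

Lemma cvg_Vs n (f : T -> 'I_n -> C) (a : 'I_n -> C) :
  (forall l, a l != 0) -> (forall l, f t l @[t --> F] --> a l) ->
  Vs (f t) @[t --> F] --> Vs a.
Proof.
move=> a0 fa; apply: cvg_bigprod => i _; apply: cvg_bigprod => j _.
apply: cvgB; last exact: cvgV.
apply: cvgB; last exact: fa.
by apply: cvgD; [exact: fa|exact: cvgV].
Qed.

Lemma cvg_horner (p : {poly C}) (f : T -> C) (a : C) :
  f t @[t --> F] --> a -> p.[f t] @[t --> F] --> p.[a].
Proof.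
move=> fa; under eq_fun do rewrite horner_coef.
rewrite horner_coef; apply: cvg_bigsum => i.
by apply: cvgM; [exact: cvg_cst|exact: cvg_exprn].
Qed.

End Continuity.

Section Density.
Variables (R : realType) (q : R).
Hypotheses (q0 : 0 < q) (q1 : q < 1).
Local Notation C := R[i].

Section Limits.
Variables (T : Type) (F : set_system T).
Context {FF : Filter F}.
Variables (G : BCD) (k N : nat) (lam : 'I_N -> int).
Variables (f : T -> 'I_k -> C) (x : 'I_k -> C).
Hypotheses (x0 : forall i, x i != 0) (fx : forall i, f t i @[t --> F] --> x i).

(** The Laurent polynomial chi is continuous at points with nonzero coordinates,
    also where the determinantal formula is 0 / 0. *)
Lemma cvg_chi_lhs : chi_lhs G q lam (f t) @[t --> F] --> chi_lhs G q lam x.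
Proof.
apply: cvgM; last exact: cvg_cst.
apply: cvg_leval => l; rewrite /qpts_prefix; case: insubP => [i _ _|_] //.
- exact: qpts_neq0.
- exact: cvg_cst.
Qed.

(** The right-hand side of the theorem times Vs(y), which is a Laurent polynomial
    in y and so makes sense without genericity. *)
Definition rhs_cleared (y : 'I_k -> C) : C :=
  ckN G q k N * Vs (@qpts R G q k) *
  \det (\matrix_(i < k, j < k)
    (chi G lam (qpts_subst G q j (y i)) / chi G lam (@qpts R G q N)
     * qweight q G k j (y i))).

Lemma det_rhsE (y : 'I_k -> C) : det_rhs G q lam y = rhs_cleared y / Vs y.
Proof.
rewrite /det_rhs /rhs_cleared mulrA mulrAC; congr (_ * _ / _).
apply: (congr1 determinant); apply/matrixP => i j; rewrite !mxE.
by rewrite -[LHS]mulrA.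
Qed.

Lemma cvg_rhs_cleared : rhs_cleared (f t) @[t --> F] --> rhs_cleared x.
Proof.
apply: cvgM; first exact: cvg_cst.
apply: cvg_det => i j; rewrite mxE; under eq_fun do rewrite mxE.
apply: cvgM; last exact: cvg_qweight.
apply: cvgM; last exact: cvg_cst.
apply: cvg_leval => l; rewrite /qpts_subst; case: ifP => _ //.
- exact: qpts_neq0.
- exact: cvg_cst.
Qed.

End Limits.

Lemma cvg_id_dnbhs0 : s @[s --> (0 : C)^'] --> (0 : C).
Proof. exact: cvg_within. Qed.

(** After the zero of p at 0 is factored out, the cofactor does not vanish at 0. *)
Lemma horner_neq0_near (p : {poly C}) : p != 0 -> \forall s \near 0^', p.[s] != 0.
Proof.
move=> p0; have [m [r r0 pE]] := multiplicity_XsubC p 0.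
rewrite p0 /= in r0.
have near_r : \forall s \near (0 : C)^', r.[s] != 0.
  have H := cvgr_neq0 _ (cvg_horner (p := r) cvg_id_dnbhs0) r0.
  exact: H.
near=> s; rewrite pE hornerM mulf_neq0 //.
  by near: s.
rewrite horner_exp expf_neq0 // !hornerE subr0.
by near: s; exact: nbhs_dnbhs_neq.
Unshelve. all: by end_near.
Qed.

(** A path through x on which every exceptional condition is a nonzero polynomial in
    the parameter: the slopes i + 1 are nonzero, which makes coordinates and
    products of coordinates nonconstant, and distinct, which does the same for
    differences. *)
Definition line k (x : 'I_k -> C) (i : 'I_k) : {poly C} := (i.+1%:R)%:P * 'X + (x i)%:P.

Lemma size_line k (x : 'I_k -> C) (i : 'I_k) : size (line x i) = 2%N.
Proof. by rewrite size_MXaddC polyC_eq0 pnatr_eq0 size_polyC pnatr_eq0. Qed.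

Lemma line_neq_const k (x : 'I_k -> C) (i : 'I_k) (c : C) : line x i - c%:P != 0.
Proof.
rewrite subr_eq0; apply/eqP => /(congr1 (fun p : {poly C} => size p)).
by rewrite size_line size_polyC; case: (_ != _).
Qed.

Lemma lineM_neq1 k (x : 'I_k -> C) (i j : 'I_k) : line x i * line x j - 1 != 0.
Proof.
have n0 l : line x l != 0 by rewrite -size_poly_eq0 size_line.
rewrite subr_eq0; apply/eqP => /(congr1 (fun p : {poly C} => size p)).
by rewrite size_mul // !size_line size_poly1.
Qed.

Lemma lineB_neq0 k (x : 'I_k -> C) (i j : 'I_k) : i != j -> line x i - line x j != 0.
Proof.
rewrite subr_eq0; apply: contraNneq => /(congr1 (fun p : {poly C} => p`_1)) /eqP.
by rewrite !coefD !coefMX !coefC !addr0 eqr_nat eqSS.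
Qed.

(** As symm z = symm w means z = w or z w = 1, genericity excludes the zeros of
    finitely many polynomials in s, and these do not accumulate at 0. *)
Lemma line_generic G k N (x : 'I_k -> C) :
  \forall s \near (0 : C)^', generic_args q G N (fun i => (line x i).[s]).
Proof.
have far i c : \forall s \near (0 : C)^', (line x i).[s] != c.
  apply: filterS (horner_neq0_near (line_neq_const x i c)) => s.
  by rewrite !hornerE subr_eq0.
have far_qpts : \forall s \near (0 : C)^', forall (i : 'I_k) (l : 'I_N),
    ((line x i).[s] != qpts G q l) && ((line x i).[s] != (qpts G q l)^-1).
  apply: filter_forall => i; apply: filter_forall => l.
  by near=> s; apply/andP; split; near: s; exact: far.
have far_units : \forall s \near (0 : C)^', forall i : 'I_k,
    [/\ (line x i).[s] != 0, (line x i).[s] != 1 & (line x i).[s] != -1].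
  by apply: filter_forall => i; near=> s; split; near: s; exact: far.
have far_pairs : \forall s \near (0 : C)^', forall i j : 'I_k, i != j ->
    ((line x i).[s] != (line x j).[s]) && ((line x i).[s] * (line x j).[s] != 1).
  apply: filter_forall => i; apply: filter_forall => j.
  have [->|ij] := eqVneq i j; first exact: nearW.
  near=> s => _; apply/andP; split; near: s.
    apply: filterS (horner_neq0_near (lineB_neq0 x ij)) => s.
    by rewrite hornerD hornerN subr_eq0.
  apply: filterS (horner_neq0_near (lineM_neq1 x i j)) => s.
  by rewrite hornerD hornerN hornerM hornerC subr_eq0.
near=> s.
have un i : [/\ (line x i).[s] != 0, (line x i).[s] != 1 & (line x i).[s] != -1].
  by move: i; near: s.
split=> [i|i|i l|i j].
- by case: (un i).
- by rewrite sqrf_eq1 negb_or; case: (un i) => _ -> ->.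
- have /andP[n1 n2] : ((line x i).[s] != qpts G q l)
      && ((line x i).[s] != (qpts G q l)^-1).
    by move: i l; near: s.
  have b0 := qpts_neq0 q0 G l.
  rewrite symm_eq //; last by case: (un i).
  rewrite (negPf n1) /=; apply: contra n2 => /eqP e.
  by rewrite -[X in X == _](mulfK b0) e div1r.
- move=> /eqP; apply: contraTeq => ij /=.
  have [ui _ _] := un i; have [uj _ _] := un j.
  rewrite symm_eq // negb_or; move: ij; move: i j {ui uj}.
  by near: s.
Unshelve. all: by end_near.
Qed.

(** Both sides are continuous at s = 0 along the path and agree for small nonzero s. *)
Lemma cleared_identity G k m (lam : 'I_(k + m) -> int) (x : 'I_k -> C) :
  (0 < k)%N -> GTplus lam -> (forall i, x i != 0) ->
  chi_lhs G q lam x * Vs x = rhs_cleared G lam x.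
Proof.
move=> k0 hlam x0.
have lx i : (line x i).[s] @[s --> (0 : C)^'] --> x i.
  have -> : x i = (line x i).[0] by rewrite !hornerE.
  exact: (cvg_horner cvg_id_dnbhs0).
apply: (@cvg_unique C _
  ((fun s => rhs_cleared G lam (fun i => (line x i).[s])) @ (0 : C)^')).
- exact: norm_hausdorff.
- apply: cvg_trans; last first.
    exact: (cvgM (cvg_chi_lhs x0 lx) (cvg_Vs x0 lx)).
  apply: near_eq_cvg; near=> s.
  have gs : generic_args q G (k + m) (fun i => (line x i).[s]).
    by near: s; exact: line_generic.
  rewrite /= (generic_identity _ _ _ _ gs) // det_rhsE divfK //.
  by case: gs => _ _ _ gI; rewrite VsE vprod_neq0.
- exact: cvg_rhs_cleared.
Unshelve. all: by end_near.
Qed.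

End Density.

(** * The theorem *)

Theorem theorem3p18 (R : realType) (q : R) (hq0 : 0 < q) (hq1 : q < 1)
  (k N : nat) (hk : (1 <= k)%N) (hkN : (k <= N)%N) (G : BCD)
  (lam : 'I_N -> int) (hlam : GTplus lam)
  (x : 'rV[R[i]]_k) (hx : forall i, x ord0 i != 0) :
  (Vs (x ord0) != 0 -> chi_lhs G q lam (x ord0) = det_rhs G q lam (x ord0)) /\
  (Vs (x ord0) = 0 ->
     (fun y : 'rV[R[i]]_k => det_rhs G q lam (y ord0))
       @ within [set y : 'rV[R[i]]_k | Vs (y ord0) != 0] (nbhs x)
     --> chi_lhs G q lam (x ord0)).
Proof.
(* With N = k + m the replaced columns form the left block of the matrix. *)
have [m NE] : exists m, N = (k + m)%N by exists (N - k)%N; rewrite subnKC.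
move: lam hlam; rewrite NE => lam hlam {N hkN NE}.
have eq_off (y : 'rV[R[i]]_k) : (forall i, y ord0 i != 0) -> Vs (y ord0) != 0 ->
    chi_lhs G q lam (y ord0) = det_rhs G q lam (y ord0).
  by move=> y0 Vy; rewrite det_rhsE -cleared_identity // mulfK.
split=> [|_]; first exact: eq_off.
have coord i : (fun y : 'rV[R[i]]_k => y ord0 i)
    @ within [set y : 'rV[R[i]]_k | Vs (y ord0) != 0] (nbhs x) --> x ord0 i.
  by apply: cvg_within_filter; exact: coord_continuous.
apply: cvg_trans; last exact: (cvg_chi_lhs hq0 (G := G) (lam := lam) hx coord).
apply: near_eq_cvg; near=> y; apply: eq_off.
  near: y; apply: filter_forall => i.
  exact: (cvgr_neq0 _ (coord i) (hx i)).
near: y; exact: withinT.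
Unshelve. all: by end_near.
Qed.
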